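(* Let $p$ be a prime and let $G$ be a special $p$-group of order $p^n$ with $d(G)=d$ and $d(\gamma_2G)=k$, where $k>2$. If $d>k+1$, then \[|M(G)|\le p^{\frac{1}{2}(d-1)(n+k)-\left(\sum_{i=2}^{k+1}(d-i)\right)-(k-2)}.\]
   Context: A finite $p$-group $G$ is special if it is non-abelian and $Z(G)=\gamma_2G=\Phi(G)$ is elementary abelian (here $Z(G)$ is the center, $\gamma_2G$ the commutator subgroup and $\Phi(G)$ the Frattini subgroup). $d(H)$ denotes the minimal number of generators of $H$, and $M(G)$ is the Schur multiplier of $G$. *)

(* Defs.v *)
From HB Require Import structures.
From mathcomp Require Import all_boot all_order all_algebra all_fingroup all_solvable.
From mathcomp Require Import all_field all_character.
Set Implicit Arguments.
Unset Strict Implicit.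
Unset Printing Implicit Defensive.
Import GRing.Theory Num.Theory.
Local Open Scope group_scope.

Definition special_pgroup (p : nat) (gT : finGroupType) (G : {group gT}) : Prop :=
  [/\ p.-group G, ~~ abelian G,
      'Z(G) = [~: G, G], 'Phi(G) = 'Z(G) & p.-abelem 'Z(G)].

Definition mingens (gT : finGroupType) (H : {set gT}) : nat :=
  \big[minn/#|H|]_(A : {set gT} | <<A>> == H) #|A|.

(* Normalized 2-cocycles are not required: a 2-cocycle of G with values in the
   multiplicative group algC^x (trivial action), only its values on G x G matter. *)
Definition cocycle2 (gT : finGroupType) (G : {set gT}) (f : gT -> gT -> algC) : Prop :=
  (forall x y, x \in G -> y \in G -> f x y != 0%R) /\
  (forall x y z, x \in G -> y \in G -> z \in G ->
     (f x y * f (x * y)%g z = f y z * f x (y * z)%g)%R).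

Definition cohomologous (gT : finGroupType) (G : {set gT})
    (f g : gT -> gT -> algC) : Prop :=
  exists t : gT -> algC, (forall x, x \in G -> t x != 0%R) /\
    (forall x y, x \in G -> y \in G -> (g x y = f x y * t x * t y / t (x * y)%g)%R).

(* |M(G)| <= m : there are at most m pairwise non-cohomologous 2-cocycles,
   i.e. H^2(G, algC^x) (= Schur multiplier M(G)) has at most m elements. *)
Definition schur_mult_order_le (gT : finGroupType) (G : {set gT}) (m : nat) : Prop :=
  forall (r : nat) (f : 'I_r -> gT -> gT -> algC),
    (forall i, cocycle2 G (f i)) ->
    (forall i j, i != j -> ~ cohomologous G (f i) (f j)) ->
    r <= m.

(* Main.v *)
(* Write V = G/Z(G) and W = Z(G) = [G, G], of dimensions d and k over F_p, and
   let [ , ] : V x V -> W be the commutator map.  For a 2-cocycle f, and z in W,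
   beta(x, z) = f(x, z) / f(z, x) is a pairing of V with W satisfying the Jacobi
   relation beta(x, [y, z]) beta(y, [z, x]) beta(z, [x, y]) = 1.

   If beta = 1, the central extension defined by f splits over W, and its
   commutators corrected by a splitting s give an alternating form alpha on V;
   f is a coboundary as soon as alpha = 1 for some s.  As there are p^k
   splittings, at most p^(d(d-1)/2 - k) classes have a given beta.

   It remains to see that the Jacobi pairings form a space of dimension at most
   k(k+1)/2 + 2.  If b vanishes on V x Y and on {x} x W, then
   b(y, [x, z]) = b(z, [x, y]), so b induces a symmetric form on
   (Y + [x, V]) / Y; iterating, at most m + m(m+1)/2 values determine the
   pairings vanishing on V x Y when Y has codimension m.  Starting with an x
   for which 2 <= dim [x, V] < k gives the bound, and such x, or one with
   [x, V] = W, exists since k > 2.  If [x, V] = W, then C(x) is strictly larger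
   than <x>W because d > k + 1: either C(x) is not abelian and b vanishes on
   V x [u, v] for some u, v in C(x), or some u in C(x) induces a non-scalar
   self-adjoint endomorphism [x, y] |-> [u, y] of W, which kills k - 1
   dimensions of symmetric forms. *)
Require Import Defs.
From HB Require Import structures.
From mathcomp Require Import all_boot all_order all_algebra all_fingroup all_solvable.
From mathcomp Require Import all_field all_character.
From mathcomp Require Import zify ring.
Set Implicit Arguments.
Unset Strict Implicit.
Unset Printing Implicit Defensive.
Import GRing.Theory Num.Theory.
Local Open Scope group_scope.

(** * Pairings satisfying the Jacobi relation *)

Lemma bin2D a b : ('C((a + b).+1, 2) = 'C(a.+1, 2) + 'C(b.+1, 2) + a * b)%N.
Proof.
elim: a => [|a IHa]; first by rewrite add0n addn0.
by rewrite addSn [LHS]binS IHa bin1 [X in _ = X + _ + _]binS bin1; lia.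
Qed.

(** The cost of one induction step of [det_all]: after [bin2D] the two sides differ by
    [m * r - m]. *)
Lemma det_all_bound m r : 0 < r ->
  m + r + ('C(r.+1, 2) + ('C(m.+1, 2) + m)) <= 'C((m + r).+1, 2) + (m + r).
Proof. by rewrite bin2D; nia. Qed.

(** By [bin2D] the right side exceeds the left by [(r - 2) * m]; [r] and [m.+1] stand for the
    dimension and codimension of [x, V] in W. *)
Lemma det_middle_bound r m : 1 < r ->
  r + m.+1 + 'C(r.+1, 2) + ('C(m.+2, 2) + m.+1) <= 'C((r + m.+1).+1, 2) + 2.
Proof. by rewrite bin2D; nia. Qed.

Lemma det_nonabelian_bound k : k + 'C(k.+1, 2) <= 'C(k.+2, 2) + 2.
Proof. by rewrite [X in _ <= X + _]binS bin1; lia. Qed.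

(** Here W has dimension [k.+2]: two full rows and a symmetric form in codimension 2 fit with one
    value to spare. *)
Lemma det_abelian_bound k :
  k.+2 + (k.+2 + 'C(k.+1, 2)) <= 'C(k.+3, 2) + 2.
Proof. by rewrite -(addn2 k) bin2D (_ : 'C(3, 2) = 3) //; lia. Qed.

(** * Symmetric forms and the upper half of their Gram matrix *)

Section Triangle.
Variables (T U : eqType) (F : T -> U).

(** The diagonal is included, so [r] vectors give r(r+1)/2 entries, as many as a symmetric form has
    parameters. *)
Fixpoint triangle (s : seq T) : seq (T * U) :=
  if s is y :: s' then [seq (y, F z) | z <- s] ++ triangle s' else [::].

Lemma triangle_cons y s :
  triangle (y :: s) = [seq (y, F z) | z <- y :: s] ++ triangle s.
Proof. by []. Qed.

Lemma size_triangle s : size (triangle s) = 'C((size s).+1, 2).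
Proof.
by elim: s => //= y s IHs; rewrite size_cat size_map IHs [RHS]binS bin1; lia.
Qed.

Lemma mem_triangle s q :
  q \in triangle s -> exists y z, [/\ y \in s, z \in s & q = (y, F z)].
Proof.
elim: s => //= y s IHs.
rewrite inE mem_cat => /or3P[/eqP->|/mapP[z sz ->]|/IHs[z [t [sz st ->]]]].
- by exists y, y; rewrite inE eqxx.
- by exists y, z; rewrite !inE eqxx sz orbT.
- by exists z, t; rewrite !inE sz st !orbT.
Qed.

Lemma triangleP (P : T -> U -> Prop) (s : seq T) :
    {in s &, forall y z, P y (F z) -> P z (F y)} ->
    {in triangle s, forall q, P q.1 q.2} ->
  {in s &, forall y z, P y (F z)}.
Proof.
elim: s => [|y s IHs] //; rewrite triangle_cons => symP triP z t.
have yP u : u \in y :: s -> P y (F u).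
  by move=> su; apply: (triP (y, F u)); rewrite mem_cat map_f.
have /IHs{}IHs : {in s &, forall y z, P y (F z) -> P z (F y)}.
  by move=> u v su sv; apply: symP; rewrite inE ?su ?sv orbT.
have {}IHs: {in s &, forall y z, P y (F z)}.
  by apply: IHs => q sq; apply: triP; rewrite mem_cat sq orbT.
rewrite inE => /predU1P[-> /yP//|sz].
rewrite inE => /predU1P[->|]; last exact: IHs.
by apply: symP; rewrite ?inE ?eqxx ?sz ?orbT //; apply: yP; rewrite inE sz orbT.
Qed.

End Triangle.

(** * Commutator calculus in class two and the space of Jacobi pairings *)

Section JacobiPairings.

Variables (p : nat) (gT : finGroupType) (G N : {group gT}).
Hypotheses (p_pr : prime p) (abelN : p.-abelem N).
Hypotheses (N_Z : 'Z(G) = N) (N_der : [~: G, G] = N).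

Implicit Types (Y : {group gT}) (b : gT -> gT -> algC).

Let sNZ : N \subset 'Z(G). Proof. by rewrite N_Z. Qed.
Let sNG : N \subset G. Proof. exact: subset_trans sNZ (center_sub G). Qed.

Lemma comm_in x y : x \in G -> y \in G -> [~ x, y] \in N.
Proof. by rewrite -N_der; exact: mem_commg. Qed.

Lemma central z x : z \in N -> x \in G -> commute z x.
Proof. by move=> /(subsetP sNZ)/centerP[_ cz] /cz. Qed.

Lemma commMl x y z : x \in G -> y \in G -> z \in G ->
  [~ x * y, z] = [~ x, z] * [~ y, z].
Proof.
move=> Gx Gy Gz; rewrite commMgJ conjgE (central (comm_in Gx Gz) Gy).
by rewrite mulKg.
Qed.

Lemma commMr x y z : x \in G -> y \in G -> z \in G ->
  [~ x, y * z] = [~ x, y] * [~ x, z].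
Proof.
move=> Gx Gy Gz; rewrite commgMJ conjgE (central (comm_in Gx Gy) Gz).
by rewrite mulKg; apply: (central _ (subsetP sNG _ _)); exact: comm_in.
Qed.

Lemma commXl x y i : x \in G -> y \in G -> [~ x ^+ i, y] = [~ x, y] ^+ i.
Proof.
move=> Gx Gy; elim: i => [|i IHi]; first by rewrite comm1g.
by rewrite !expgS commMl ?groupX // IHi.
Qed.

Lemma commXr x y i : x \in G -> y \in G -> [~ x, y ^+ i] = [~ x, y] ^+ i.
Proof.
move=> Gx Gy; elim: i => [|i IHi]; first by rewrite commg1.
by rewrite !expgS commMr ?groupX // IHi.
Qed.

Lemma commVr x y : x \in G -> y \in G -> [~ x, y^-1] = [~ x, y]^-1.
Proof.
move=> Gx Gy; apply/eqP; rewrite eq_sym eq_invg_mul -commMr ?groupV //.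
by rewrite mulgV commg1.
Qed.

Lemma order_N z : z \in N -> z != 1 -> #[z] = p.
Proof. by move=> Nz; apply: (abelem_order_p abelN). Qed.

Lemma cycle_N_eq z w : z \in N -> w \in <[z]> -> w != 1 -> <[w]> = <[z]>.
Proof.
move=> Nz zw w1; have z1: z != 1.
  by apply: contraNneq w1 => z1; move: zw; rewrite z1 cycle1 inE.
have Nw: w \in N by apply: subsetP zw; rewrite cycle_subG.
by apply/eqP; rewrite eqEcard cycle_subG zw -!orderE !order_N /=.
Qed.

Lemma card_gen_add Y z : Y \subset N -> z \in N -> z \notin Y ->
  #|<<z |: Y>>| = (p * #|Y|)%N.
Proof.
move=> sYN Nz Y'z.
have z1: z != 1 by apply: contraNneq Y'z => ->.
have -> : <<z |: Y>> = <[z]> * Y.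
  rewrite -joingE -joing_idl -norm_joinEr //.
  apply: subset_trans (subset_trans sYN _) (cent_sub _).
  rewrite sub_abelian_cent //; first exact: (abelem_abelian abelN).
  by rewrite cycle_subG.
rewrite TI_cardMg -?orderE ?order_N //.
apply: prime_TIg; first by rewrite -orderE order_N.
by rewrite cycle_subG.
Qed.

(** Greedy choice of a basis: while some [F x] escapes the current subgroup, adjoining it multiplies
    the order by [p]. Thus [size s] is the dimension, modulo [Y], of the span of the values of
    [F]. *)
Lemma gens_mod (F : gT -> gT) (P : {set gT}) Y :
    Y \subset N -> {in P, forall x, F x \in N} ->
  exists s : seq gT,
    [/\ {subset s <= P}, F @: P \subset <<Y :|: [set F x | x in s]>>
      & #|<<Y :|: [set F x | x in s]>>| = (p ^ size s * #|Y|)%N].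
Proof.
have [m] := ubnP (#|N| - #|Y|); elim: m Y => // m IHm Y lem sYN FN.
case sFY: (F @: P \subset Y).
  exists [::]; split=> //=.
    exact: subset_trans sFY (sub_gen (subsetUl _ _)).
  rewrite mul1n; congr #|pred_of_set _|; apply/eqP.
  rewrite eqEsubset gen_subG subUset subxx /= sub_gen ?subsetUl // andbT.
  by apply/subsetP=> z /imsetP[].
have /subsetPn[_ /imsetP[x Px ->] Y'Fx] := negbT sFY.
have cardY1 := card_gen_add sYN (FN x Px) Y'Fx.
have sY1N : <<F x |: Y>> \subset N.
  by rewrite gen_subG subUset sub1set FN.
have [|||s [sP sF cards]] := IHm <<F x |: Y>>%G.
- have := subset_leq_card sY1N; rewrite /= cardY1.
  have := ltn_Pmull (prime_gt1 p_pr) (cardG_gt0 Y).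
  move=> ltYpY lepYN; rewrite ltnS in lem; apply: leq_trans lem; rewrite ltn_sub2l //.
  exact: leq_trans lepYN.
- by [].
- by [].
have eqs: <<<<F x |: Y>> :|: [set F x | x in s]>>
      = <<Y :|: [set F y | y in x :: s]>>.
  rewrite -[LHS]joingE joing_idl joingE; rewrite setUAC setUC.
  congr <<Y :|: _>>; apply/setP=> y; apply/setU1P/imsetP.
    move=> [->|/imsetP[z sz ->]]; first by exists x; rewrite ?mem_head.
    by exists z; rewrite // inE sz orbT.
  by move=> [z /predU1P[->->|sz ->]]; [left | right; rewrite imset_f].
exists (x :: s); split.
- by move=> y; rewrite inE => /predU1P[->|/sP].
- by rewrite -eqs.
- by rewrite -eqs cards cardY1 /= expnS mulnCA mulnA.
Qed.

(* Dually: b is an element of V* (x) N* annihilating the image of the Jacobi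
   map from the exterior cube of V = G / N to V (x) N. *)
Record jacobi b : Prop := Jacobi {
  jac_neq0 : {in G & N, forall x z, b x z != 0%R};
  jacMl : forall x y z, x \in G -> y \in G -> z \in N ->
    b (x * y) z = (b x z * b y z)%R;
  jacMr : forall x z w, x \in G -> z \in N -> w \in N ->
    b x (z * w) = (b x z * b x w)%R;
  jacJ : forall x y z, x \in G -> y \in G -> z \in G ->
    b y [~ x, z] = (b x [~ y, z] * b z [~ x, y])%R }.

Definition trivial_on b (A B : {set gT}) := {in A & B, forall x z, b x z = 1%R}.

Lemma jac1r b x : jacobi b -> x \in G -> b x 1 = 1%R.
Proof.
move=> jb Gx; apply: (mulfI (jac_neq0 jb Gx (group1 N))).
by rewrite -(jacMr jb) // mulg1 mulr1.
Qed.

Lemma trivial_gen b x (A : {set gT}) : jacobi b -> x \in G -> A \subset N ->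
  {in A, forall z, b x z = 1%R} -> {in <<A>>, forall z, b x z = 1%R}.
Proof.
move=> jb Gx sAN bA.
have gK: group_set [set z in N | b x z == 1%R].
  apply/group_setP; split; first by rewrite inE group1 jac1r //=.
  move=> z w; rewrite !inE => /andP[Nz /eqP bz] /andP[Nw /eqP bw].
  by rewrite groupM //= (jacMr jb) // bz bw mulr1.
have /subsetP sAK: <<A>> \subset group gK.
  rewrite gen_subG; apply/subsetP=> z Az.
  by rewrite inE (subsetP sAN) //= bA.
by move=> z /sAK; rewrite inE => /andP[_ /eqP].
Qed.

(** For subspaces [A] and [B] of Jacobi pairings, this expresses that their intersection has
    codimension at most [q] in [A]. The evaluation points are kept explicit because they later serve
    as coordinates of a cohomology class. *)
Definition determines q (A B : (gT -> gT -> algC) -> Prop) :=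
  exists L : seq (gT * gT),
  [/\ size L <= q, {in L, forall c, (c.1 \in G) && (c.2 \in N)}
    & forall b, jacobi b -> A b -> {in L, forall c, b c.1 c.2 = 1%R} -> B b].

Lemma det_trans q1 q2 q (B A C : (gT -> gT -> algC) -> Prop) :
  determines q1 A B -> determines q2 B C -> q1 + q2 <= q -> determines q A C.
Proof.
move=> [L1 [le1 in1 det1]] [L2 [le2 in2 det2]] leq; exists (L1 ++ L2); split.
- by rewrite size_cat (leq_trans (leq_add le1 le2)).
- by move=> c; rewrite mem_cat => /orP[/in1|/in2].
move=> b jb Ab bL; apply: det2 => //; last first.
  by move=> c c2; apply: bL; rewrite mem_cat c2 orbT.
by apply: det1 => // c c1; apply: bL; rewrite mem_cat c1.
Qed.

Lemma det_weaken q A B (A' B' : (gT -> gT -> algC) -> Prop) :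
    determines q A B -> (forall b, jacobi b -> A' b -> A b) ->
    (forall b, jacobi b -> A' b -> B b -> B' b) ->
  determines q A' B'.
Proof.
move=> [L [leL inL detL]] sA sB; exists L; split=> // b jb A'b bL.
by apply: sB => //; apply: detL => //; apply: sA.
Qed.

(** The row [b x] is a character of [N] trivial on [Y], so it is tested on a basis of [N] modulo
    [Y]. *)
Lemma det_row (A : (gT -> gT -> algC) -> Prop) x Y m :
    x \in G -> Y \subset N -> #|N| = (p ^ m * #|Y|)%N ->
    (forall b, jacobi b -> A b -> trivial_on b [set x] Y) ->
  determines m A (fun b => A b /\ trivial_on b [set x] N).
Proof.
move=> Gx sYN cardN AY.
have [|s [sN sNs cards]] := @gens_mod id N Y sYN; first by [].
have {}sNs: N \subset <<Y :|: [set z | z in s]>> by rewrite imset_id in sNs.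
have sYsN: Y :|: [set z | z in s] \subset N.
  by rewrite subUset sYN; apply/subsetP=> _ /imsetP[z /sN Nz ->].
exists [seq (x, z) | z <- s]; split.
- rewrite size_map -(leq_exp2l _ _ (prime_gt1 p_pr)) -(leq_pmul2r (cardG_gt0 Y)).
  by rewrite -cards -cardN subset_leq_card // gen_subG.
- by move=> _ /mapP[z /sN Nz ->] /=; rewrite Gx.
move=> b jb Ab bs; split=> // _ z /set1P-> Nz.
apply: (trivial_gen jb Gx sYsN); last exact: subsetP Nz.
move=> w /setUP[Yw|/imsetP[t st ->]]; first by apply: (AY b); rewrite ?set11.
by apply: (bs (x, t)); rewrite map_f.
Qed.

Definition brackets x : {set gT} := [set [~ x, y] | y in G].

Lemma brackets_sub x : x \in G -> brackets x \subset N.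
Proof. by move=> Gx; apply/subsetP=> _ /imsetP[y Gy ->]; apply: comm_in. Qed.

(** Once the row of [x] vanishes, Jacobi makes [b y [~ x, z]] symmetric in [y] and [z]. It is tested
    on elements whose brackets with [x] form a basis modulo [Y]. *)
Lemma det_step x Y r : x \in G -> Y \subset N ->
    #|<<Y :|: brackets x>>| = (p ^ r * #|Y|)%N ->
  determines 'C(r.+1, 2)
    (fun b => trivial_on b G Y /\ trivial_on b [set x] N)
    (fun b => trivial_on b G <<Y :|: brackets x>>).
Proof.
move=> Gx sYN cardY'.
have [|s [sG sFs cards]] := @gens_mod (fun y => [~ x, y]) G Y sYN.
  by move=> y Gy; apply: comm_in.
have sN: Y :|: [set [~ x, y] | y in s] \subset N.
  rewrite subUset sYN; apply/subsetP=> _ /imsetP[z /sG Nz ->].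
  exact: comm_in.
exists (triangle (fun y => [~ x, y]) s); split.
- rewrite size_triangle leq_bin2l // ltnS.
  rewrite -(leq_exp2l _ _ (prime_gt1 p_pr)) -(leq_pmul2r (cardG_gt0 Y)).
  rewrite -cards -cardY' subset_leq_card // genS // setUS //.
  by apply/subsetP=> _ /imsetP[z /sG Nz ->]; apply: imset_f.
- by move=> _ /mem_triangle[y [z [/sG Gy /sG Gz ->]]] /=; rewrite Gy comm_in.
move=> b jb [bY bx] bs.
have b_sym y z : y \in G -> z \in G -> b y [~ x, z] = b z [~ x, y].
  move=> Gy Gz; rewrite (jacJ jb) // (bx x) ?set11 ?mul1r //.
  exact: comm_in.
have bss: {in s &, forall y z, b y [~ x, z] = 1%R}.
  apply: (@triangleP _ _ _ (fun y w => b y w = 1%R)) => [y z|q sq]; last exact: bs.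
  move=> /sG Gy /sG Gz.
  by rewrite b_sym.
(* Linearity first frees the second argument; symmetry then exchanges the arguments, so that the
   first one becomes free too. *)
have bsG y w : y \in s -> w \in G -> b y [~ x, w] = 1%R.
  move=> sy Gw; apply: (trivial_gen jb (sG _ sy) sN).
    move=> z /setUP[Yz|/imsetP[t st ->]]; last exact: bss.
    by apply: bY; rewrite ?sG.
  by apply: (subsetP sFs); apply: imset_f.
move=> y z Gy; apply: (trivial_gen jb Gy).
  by rewrite subUset sYN brackets_sub.
move=> w /setUP[|/imsetP[t Gt ->]]; first exact: bY.
apply: (trivial_gen jb Gy sN); last first.
  by apply: (subsetP sFs); apply: imset_f.
move=> v /setUP[|/imsetP[u su ->]]; first exact: bY.
by have Gu := sG u su; rewrite b_sym // bsG.
Qed.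

Lemma card_over Y Y' : Y \subset Y' -> Y' \subset N ->
  exists2 r, #|Y'| = (p ^ r * #|Y|)%N & (r == 0) = (Y == Y' :> {set gT}).
Proof.
move=> sYY' sY'N; have pY' := pgroupS sY'N (abelem_pgroup abelN).
have /p_natP[r defr] := pnat_dvd (dvdn_indexg Y' Y) pY'.
exists r; first by rewrite -defr mulnC Lagrange.
rewrite eqEsubset sYY' /= -indexg_eq1 defr.
by have := prime_gt1 p_pr; case: r {defr} => //= r p1; rewrite expnS; nia.
Qed.

(** If [Y] is proper, some commutator [x, y] lies outside it because commutators generate [N].
    Joining [brackets x] to [Y] then strictly lowers the codimension [m]. *)
Lemma det_all Y m : Y \subset N -> #|N| = (p ^ m * #|Y|)%N ->
  determines ('C(m.+1, 2) + m) (fun b => trivial_on b G Y)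
                               (fun b => trivial_on b G N).
Proof.
elim/ltn_ind: m Y => m IHm Y sYN cardN.
have [sNY|] := boolP (N \subset Y).
  exists [::]; split=> // b _ bY _; have -> // : N :=: Y.
  by apply/eqP; rewrite eqEsubset sNY.
rewrite -{1}N_der gen_subG => /subsetPn[_ /imset2P[x y Gx Gy ->] Y'xy].
set Y' := <<Y :|: brackets x>>%G.
have sYY' : Y \subset Y' by rewrite sub_gen ?subsetUl.
have sY'N : Y' \subset N by rewrite gen_subG subUset sYN brackets_sub.
have [r cardY' r0] := card_over sYY' sY'N.
have [m' cardN' _] := card_over sY'N (subxx N).
have def_m: m = m' + r.
  apply/eqP; rewrite -(eqn_exp2l _ _ (prime_gt1 p_pr)) expnD.
  by rewrite -(eqn_pmul2r (cardG_gt0 Y)) -cardN cardN' cardY' mulnA.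
have r_gt0: 0 < r.
  rewrite lt0n r0; apply: contraNneq Y'xy => ->.
  by rewrite mem_gen // inE imset_f ?orbT.
apply: (det_trans (det_row Gx sYN cardN _)
  (det_trans (det_step Gx sYN cardY') (IHm m' _ Y' sY'N cardN') (leqnn _))).
- by move=> b _ bY _ z /set1P->; apply: bY.
- by rewrite def_m -[X in X < _]addn0 ltn_add2l.
- by rewrite def_m; apply: det_all_bound.
Qed.

(** * Bounds obtained from a single element [x] *)

Lemma brackets_group_set x : x \in G -> group_set (brackets x).
Proof.
move=> Gx; apply/group_setP; split.
  by apply/imsetP; exists 1; rewrite ?commg1.
move=> _ _ /imsetP[y Gy ->] /imsetP[z Gz ->].
by rewrite -commMr // imset_f ?groupM.
Qed.

Lemma gen_brackets x : x \in G -> <<1%G :|: brackets x>> = brackets x.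
Proof.
move=> Gx; have gW := brackets_group_set Gx.
rewrite -[RHS](gen_set_id gW); congr <<_>>; apply/setUidPr.
by rewrite sub1set; case/group_setP: gW.
Qed.

(** The translate of [brackets x] by [x] is the conjugacy class of [x]. *)
Lemma card_brackets x : x \in G -> (#|'C_G[x]| * #|brackets x|)%N = #|G|.
Proof.
move=> Gx; rewrite -(Lagrange (subcent1_sub x G)) index_cent1; congr (_ * _)%N.
rewrite -(card_lcoset (brackets x) x); congr #|pred_of_set _|.
apply/setP=> z; rewrite mem_lcoset; apply/imsetP/imsetP.
  by move=> [y Gy def_z]; exists y; rewrite // -[z](mulKVg x) def_z commgEl mulKVg.
by move=> [y Gy ->]; exists y; rewrite // commgEl.
Qed.


Lemma trivial_on1 b (A : {set gT}) : jacobi b -> A \subset G -> trivial_on b A 1.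
Proof. by move=> jb sAG x z Ax /set1P->; rewrite jac1r // (subsetP sAG). Qed.

(** The row of [x] costs [r + m] values and the symmetric form on [brackets x] the binomial in [r];
    [det_all] finishes with [Y = brackets x]. *)
Lemma det_middle x r m : x \in G -> #|brackets x| = (p ^ r)%N ->
    #|N| = (p ^ (r + m))%N ->
  determines ((r + m) + 'C(r.+1, 2) + ('C(m.+1, 2) + m)) (fun=> True)
             (fun b => trivial_on b G N).
Proof.
move=> Gx cardW cardN.
have sWN : <<1%G :|: brackets x>> \subset N by rewrite gen_brackets ?brackets_sub.
have step1 : determines (r + m) (fun=> True)
    (fun b => True /\ trivial_on b [set x] N).
  apply: (@det_row (fun=> True) x 1%G (r + m)); rewrite ?sub1G ?cards1 ?muln1 //.
  by move=> b jb _; apply: trivial_on1; rewrite ?sub1set.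
have step2 := @det_step x 1%G r Gx (sub1G N).
rewrite gen_brackets // cards1 muln1 in step2.
have step3 := @det_all (group (brackets_group_set Gx)) m (brackets_sub Gx).
rewrite -addnA; apply: (det_trans step1 _ (leqnn _)).
apply: (det_trans _ (step3 _) (leqnn _)); last first.
  by rewrite /= cardW cardN mulnC expnD.
apply: (det_weaken (step2 cardW)) => // b jb [_ bx]; split=> //.
exact: trivial_on1.
Qed.

(** Jacobi at [x], [u], [v] forces [b x [~ u, v] = 1], which saves one value in the row of [x];
    [det_step] is then applied modulo the line of [[~ u, v]]. *)
Lemma det_full_nonabelian x u v k : x \in G -> brackets x = N ->
    u \in 'C_G[x] -> v \in 'C_G[x] -> [~ u, v] != 1 ->
    #|N| = (p ^ k.+1)%N ->
  determines (k + 'C(k.+1, 2)) (fun=> True) (fun b => trivial_on b G N).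
Proof.
move=> Gx defN /setIP[Gu /cent1P cux] /setIP[Gv /cent1P cvx] uv1 cardN.
have Nuv : [~ u, v] \in N by apply: comm_in.
have sYN : <[[~ u, v]]> \subset N by rewrite cycle_subG.
have cardY : #|<[[~ u, v]]>| = p by rewrite -orderE order_N.
have xu1 : [~ x, u] = 1 by apply/eqP/commgP.
have xv1 : [~ x, v] = 1 by apply/eqP/commgP.
have step1 : determines k (fun=> True) (fun b => True /\ trivial_on b [set x] N).
  apply: (@det_row (fun=> True) x <[[~ u, v]]>%G k) => //.
    by rewrite cardY cardN expnS mulnC.
  move=> b jb _ _ z /set1P->; apply: (trivial_gen jb Gx).
    by rewrite sub1set.
  move=> _ /set1P->; have := jacJ jb Gx Gu Gv.
  by rewrite xv1 xu1 !jac1r // mulr1.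
have YW : <<<[[~ u, v]]>%G :|: brackets x>> = N.
  by rewrite defN (setUidPr sYN) genGid.
have step2 := @det_step x <[[~ u, v]]>%G k Gx sYN.
rewrite YW /= cardY cardN expnS mulnC in step2.
apply: (det_trans step1 _ (leqnn _)).
apply: (det_weaken (step2 erefl)) => // b jb [_ bx]; split=> // y w Gy.
have b_sym y1 z1 : y1 \in G -> z1 \in G -> b y1 [~ x, z1] = b z1 [~ x, y1].
  move=> Gy1 Gz1; rewrite (jacJ jb) // (bx x) ?set11 ?mul1r //.
  exact: comm_in.
(* Since [N = brackets x], symmetry kills the whole row of any [t] centralizing [x]. For [t = u] and
   [t = v], Jacobi then gives [b y [~ u, v] = 1]. *)
have bC t : t \in G -> [~ x, t] = 1 -> {in N, forall z, b t z = 1%R}.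
  move=> Gt xt1 z; rewrite -{1}defN => /imsetP[s Gs ->].
  by rewrite b_sym // xt1 jac1r.
apply: (trivial_gen jb Gy); first by rewrite sub1set.
by move=> _ /set1P->; rewrite (jacJ jb Gu Gy Gv) !bC ?mulr1 ?comm_in.
Qed.

(* Here [x, y] |-> [u, y] is a well-defined endomorphism of N = [x, G], for
   which the symmetric form ([x, y], [x, z]) |-> b y [x, z] is self-adjoint. *)
Lemma det_full_abelian x u y0 k : x \in G -> brackets x = N ->
    u \in 'C_G[x] -> y0 \in G -> [~ x, y0] != 1 ->
    [~ u, y0] \notin <[[~ x, y0]]> -> #|N| = (p ^ k.+2)%N ->
  determines (k.+2 + (k.+2 + 'C(k.+1, 2))) (fun=> True) (fun b => trivial_on b G N).
Proof.
move=> Gx defN /setIP[Gu /cent1P cux] Gy0 c0_1 c1_c0 cardN.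
set c0 := [~ x, y0] in c0_1 c1_c0; set c1 := [~ u, y0] in c1_c0.
have Nc0 : c0 \in N by apply: comm_in.
have Nc1 : c1 \in N by apply: comm_in.
have xu1 : [~ x, u] = 1 by apply/eqP/commgP.
have sc0N : <[c0]> \subset N by rewrite cycle_subG.
set Y := <<c1 |: <[c0]> >>%G.
have sYN : Y \subset N by rewrite gen_subG subUset sub1set Nc1.
have cardY : #|Y| = (p * p)%N.
  by rewrite card_gen_add // -orderE order_N.
have row (A : (gT -> gT -> algC) -> Prop) y :
    y \in G -> determines k.+2 A (fun b => A b /\ trivial_on b [set y] N).
  move=> Gy; apply: (@det_row A y 1%G); rewrite ?sub1G ?cards1 ?muln1 //.
  by move=> b jb _; apply: trivial_on1; rewrite ?sub1set.
have YW : <<Y :|: brackets x>> = N by rewrite defN (setUidPr sYN) genGid.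
have step := @det_step x Y k Gx sYN.
rewrite YW cardY cardN mulnA -!expnSr in step.
apply: (det_trans (row (fun=> True) x Gx) _ (leqnn _)).
apply: (det_trans (row _ y0 Gy0) _ (leqnn _)).
apply: (det_weaken (step erefl)) => // b jb [[_ bx] by0]; split=> // y w Gy.
have b_sym t z : t \in G -> z \in G -> b t [~ x, z] = b z [~ x, t].
  move=> Gt Gz; rewrite (jacJ jb) // (bx x) ?set11 ?mul1r //.
  exact: comm_in.
have bu : {in N, forall z, b u z = 1%R}.
  move=> z; rewrite -{1}defN => /imsetP[s Gs ->].
  by rewrite b_sym // xu1 jac1r.
(* The rows of [x], [u] and [y0] vanish, so Jacobi makes [b y] trivial at both generators
   [[~ u, y0]] and [[~ x, y0]] of [Y]. *)
apply: (trivial_gen jb Gy); first by rewrite subUset sub1set Nc1.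
move=> z /setU1P[->|].
  by rewrite (jacJ jb Gu Gy Gy0) bu ?comm_in // mul1r by0 ?set11 ?comm_in.
apply: (trivial_gen jb Gy); first by rewrite sub1set.
by move=> _ /set1P->; rewrite b_sym // by0 ?set11 ?comm_in.
Qed.

(** An endomorphism having every vector as an eigenvector is scalar. For [x, y] |-> [u, y] this
    would make some [x ^+ i * u] central. *)
Lemma nonscalar_bracket x u : x \in G -> u \in G -> N :!=: 1 ->
    brackets x = N -> {in 'C_G[x], forall v, [~ u, v] = 1} ->
    (forall i, i < p -> x ^+ i * u \notin N) ->
  exists y, [/\ y \in G, [~ x, y] != 1 & [~ u, y] \notin <[[~ x, y]]>].
Proof.
move=> Gx Gu ntN defN cuC xuN.
have C_x y : y \in G -> [~ x, y] = 1 -> y \in 'C_G[x].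
  move=> Gy xy1; rewrite inE Gy /=; apply/cent1P.
  by apply/commute_sym/commgP/eqP.
suff [y [Gy uy]] : exists y, y \in G /\ [~ u, y] \notin <[[~ x, y]]>.
  exists y; split=> //; apply: contraNneq uy => xy1.
  by rewrite cuC ?C_x.
have [/exists_inP[y Gy uy]|] :=
  boolP [exists y in G, [~ u, y] \notin <[[~ x, y]]>]; first by exists y.
rewrite negb_exists_in => /forall_inP scal.
have {}scal y : y \in G -> [~ u, y] \in <[[~ x, y]]>.
  by move/scal; rewrite negbK.
have [c0 Nc0 c0_1] : exists2 c0, c0 \in N & c0 != 1.
  by apply/trivgPn.
move: (Nc0); rewrite -{1}defN => /imsetP[y0 Gy0 def_c0].
(* The exponent [j] removes the eigenvalue at [c0]: [u' = x ^+ j * u] commutes with [y0]. *)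
have /cyclePmin[j] : [~ u, y0]^-1 \in <[c0]> by rewrite groupV def_c0 scal.
rewrite order_N // => lt_jp def_j.
pose u' := x ^+ j * u.
have Gu' : u' \in G by rewrite groupM ?groupX.
have u'E y : y \in G -> [~ u', y] = [~ x, y] ^+ j * [~ u, y].
  by move=> Gy; rewrite commMl ?groupX // commXl.
have u'y0 : [~ u', y0] = 1 by rewrite u'E // -def_c0 -def_j mulVg.
have cu'C v : v \in 'C_G[x] -> [~ u', v] = 1.
  move=> Cv; have [Gv /cent1P cvx] := setIP Cv.
  rewrite u'E // cuC // mulg1 (_ : [~ x, v] = 1) ?expg1n //.
  by apply/eqP/commgP.
have u'scal y : y \in G -> [~ u', y] \in <[[~ x, y]]>.
  by move=> Gy; rewrite u'E // groupM ?mem_cycle ?scal.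
have [y Gy u'y] : exists2 y, y \in G & [~ u', y] != 1.
  apply/exists_inP; apply: contraNT (xuN j lt_jp).
  rewrite negb_exists_in => /forall_inP u'Z.
  rewrite -N_Z; apply/centerP; split=> // y Gy.
  by apply/commgP; rewrite -[_ == _]negbK u'Z.
set c := [~ x, y].
have Nc : c \in N by apply: comm_in.
have c_c0 : c \notin <[c0]>.
  apply: contra u'y => /cycleP[i def_c].
  have Cyy : y * (y0 ^+ i)^-1 \in 'C_G[x].
    apply: C_x; first by rewrite groupM ?groupV ?groupX.
    by rewrite commMr ?groupV ?groupX // commVr ?groupX // commXr // -def_c0
      -def_c mulgV.
  have := cu'C _ Cyy; rewrite commMr ?groupV ?groupX // commVr ?groupX //.
  by rewrite commXr // u'y0 expg1n invg1 mulg1 => ->.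
have e_eq : [~ u', y * y0] = [~ u', y] by rewrite commMr // u'y0 mulg1.
have cy0 : [~ x, y * y0] = c * c0 by rewrite commMr // -def_c0.
have Ncc0 : c * c0 \in N by rewrite groupM.
(* Both [c] and [c * c0] are eigenvectors with the same nontrivial image, so they span one line,
   which then contains [c0]. *)
have e_c : <[[~ u', y]]> = <[c]> by apply: cycle_N_eq; rewrite ?u'scal.
have e_cc0 : <[[~ u', y]]> = <[c * c0]>.
  by apply: cycle_N_eq; rewrite // -cy0 -e_eq u'scal ?groupM.
have c0_c : c0 \in <[c]>.
  have : c * c0 \in <[c]> by rewrite -e_c e_cc0 cycle_id.
  by rewrite groupMl ?cycle_id.
by case/negP: c_c0; rewrite (cycle_N_eq Nc c0_c c0_1) cycle_id.
Qed.

Lemma det_full x k : x \in G -> brackets x = N -> #|N| = (p ^ k)%N -> 2 < k ->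
    (p * #|N| * #|N| < #|G|)%N ->
  determines ('C(k.+1, 2) + 2) (fun=> True) (fun b => trivial_on b G N).
Proof.
move=> Gx defN cardN k_gt2 ltNG.
case: k cardN k_gt2 => [|[|k]] // cardN k_gt2.
have [/existsP[[u v] /and3P[/= Cu Cv uv1]]|abelC] :=
  boolP [exists c : gT * gT,
     [&& c.1 \in 'C_G[x], c.2 \in 'C_G[x] & [~ c.1, c.2] != 1]].
  have [L [leL inL detL]] := det_full_nonabelian Gx defN Cu Cv uv1 cardN.
  exists L; split=> //; apply: leq_trans leL _.
  exact: det_nonabelian_bound.
have {}abelC : {in 'C_G[x] &, forall u v, [~ u, v] = 1}.
  move=> u v Cu Cv; apply/eqP; apply: contraNT abelC => uv1.
  by apply/existsP; exists (u, v); rewrite /= Cu Cv.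
(* There are at most [p * #|N|] such products, while [card_brackets] and the bound on [#|G|], which
   encodes d > k + 1, make the centralizer of [x] larger. *)
pose A := [set (x ^+ (i : 'I_p * gT).1)^-1 * i.2 | i in setX [set: 'I_p] N].
have /subsetPn[u Cu A'u] : ~~ ('C_G[x] \subset A).
  apply/negP=> /subset_leq_card; rewrite leqNgt => /negP[].
  rewrite -(ltn_pmul2r (cardG_gt0 N)) -{2}defN card_brackets //.
  apply: leq_ltn_trans ltNG; rewrite leq_mul2r orbC.
  apply/orP; left; apply: leq_trans (leq_imset_card _ _) _.
  by rewrite cardsX cardsT card_ord.
have Gu : u \in G by case/setIP: Cu.
have [||i lt_ip|y [Gy xy1 uy]] := nonscalar_bracket Gx Gu _ defN.
- by rewrite -cardG_gt1 cardN -(expn0 p) ltn_exp2l ?prime_gt1.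
- by move=> v; apply: abelC.
- apply: contra A'u => Nxu; apply/imsetP.
  exists (Ordinal lt_ip, x ^+ i * u); rewrite ?mulKg //.
  by rewrite !inE.
have [L [leL inL detL]] := det_full_abelian Gx defN Cu Gy xy1 uy cardN.
exists L; split=> //; apply: leq_trans leL _.
exact: det_abelian_bound.
Qed.

(** If all [brackets x] had order at most [p], take commutators [t = [~ x, z]] and [t' = [~ y, w]]
    on different lines. The mixed ones [[~ x, w]] and [[~ y, z]] lie on both lines, hence are
    trivial, and [brackets (x * y)] contains both [t] and [t']. *)
Lemma brackets_large : p < #|N| -> exists2 x, x \in G & p < #|brackets x|.
Proof.
move=> ltpN; apply/exists_inP; apply: contraTT ltpN.
rewrite negb_exists_in => /forall_inP small; rewrite -leqNgt.
have mem_br a h : a \in G -> h \in G ->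
    [~ a, h] \in brackets a /\ [~ a, h] \in brackets h.
  move=> Ga Gh; split; first exact: imset_f.
  rewrite -invg_comm -[_^-1]commVr //.
  by apply/imsetP; exists a^-1; rewrite ?groupV.
have lineE g t : g \in G -> t \in brackets g -> t != 1 -> brackets g = <[t]>.
  move=> Gg gt t1; apply/eqP; rewrite eq_sym eqEcard.
  have Nt := subsetP (brackets_sub Gg) t gt.
  rewrite -orderE order_N // leqNgt small // andbT.
  by have := cycle_subG t (group (brackets_group_set Gg)); rewrite gt => ->.
have [abelG|] := boolP (abelian G).
  rewrite -N_der (eqP (_ : [~: G, G] == 1)) ?cards1 ?prime_gt0 //.
  by rewrite (sameP eqP commG1P).
rewrite -[abelian G]/(G \subset 'C(G)) => nab.
have /subsetPn[_ /imset2P[x z Gx Gz ->] xz] : ~~ (commg_set G G \subset [1]).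
  by apply: contra nab; rewrite -gen_subG; rewrite (sameP commG1P trivgP).
set t := [~ x, z]; rewrite inE in xz.
have Nt : t \in N by apply: comm_in.
have [xt zt] := mem_br x z Gx Gz.
have Wx := lineE x t Gx xt xz; have Wz := lineE z t Gz zt xz.
rewrite leqNgt; apply/negP=> ltpN.
have : ~~ (N \subset <[t]>).
  by apply: contraL ltpN => /subset_leq_card; rewrite -orderE order_N // leqNgt.
rewrite -{1}N_der gen_subG => /subsetPn[_ /imset2P[y w Gy Gw ->] yw].
set t' := [~ y, w] in yw.
have Nt' : t' \in N by apply: comm_in.
have t'1 : t' != 1 by apply: contraNneq yw => ->.
have [yt' wt'] := mem_br y w Gy Gw.
have Wy := lineE y t' Gy yt' t'1; have Ww := lineE w t' Gw wt' t'1.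
have tiW c : c \in <[t]> -> c \in <[t']> -> c = 1.
  move=> tc t'c; apply/eqP; apply: contraNT yw => c1.
  change (t' \in <[t]>).
  by rewrite -(cycle_N_eq Nt tc c1) (cycle_N_eq Nt' t'c c1) cycle_id.
have xw : [~ x, w] = 1.
  by have [] := mem_br x w Gx Gw; rewrite Wx Ww; apply: tiW.
have yz : [~ y, z] = 1.
  have [] := mem_br y z Gy Gz; rewrite Wy Wz => ? ?; exact: tiW.
have Gxy : x * y \in G by rewrite groupM.
have Wxy : brackets (x * y) = <[t]>.
  by apply: lineE => //; apply/imsetP; exists z; rewrite // commMl // yz mulg1.
have : t' \notin <[t]> := yw.
case/negP; rewrite -Wxy; apply/imsetP; exists w => //.
by rewrite commMl // xw mul1g.
Qed.

Lemma jacobi_determined k : #|N| = (p ^ k)%N -> 2 < k ->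
    (p * #|N| * #|N| < #|G|)%N ->
  determines ('C(k.+1, 2) + 2) (fun=> True) (fun b => trivial_on b G N).
Proof.
move=> cardN k_gt2 ltNG; have p_gt1 := prime_gt1 p_pr.
have [|x Gx ltpW] := brackets_large.
  by rewrite cardN -{1}(expn1 p) ltn_exp2l //; apply: ltnW.
have [||r cardW _] := @card_over 1%G (group (brackets_group_set Gx)).
- exact: sub1G.
- exact: brackets_sub.
rewrite /= cards1 muln1 in cardW.
have r_gt1 : 1 < r by rewrite -(ltn_exp2l _ _ p_gt1) expn1 -cardW.
have le_rk : r <= k.
  rewrite -(leq_exp2l _ _ p_gt1) -cardW -cardN subset_leq_card //.
  exact: brackets_sub.
have [eq_rk|ne_rk] := eqVneq r k.
  apply: (det_full Gx _ cardN k_gt2 ltNG).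
  by apply/eqP; rewrite eqEcard brackets_sub // cardW cardN eq_rk /=.
have [m def_k] : exists m, k = r + m.+1.
  by exists (k - r).-1; rewrite prednK ?subnKC ?subn_gt0 // ltn_neqAle ne_rk.
rewrite def_k in cardN *.
have [L [leL inL detL]] := det_middle Gx cardW cardN.
exists L; split=> //; apply: leq_trans leL _.
exact: det_middle_bound.
Qed.

End JacobiPairings.

(** * The twisted regular representation *)

Section TwistedRegular.

Variables (gT : finGroupType) (G : {group gT}) (f : gT -> gT -> algC).
Hypothesis cf : cocycle2 G f.

Let rk := enum_rank_in (group1 G).
Let el (i : 'I_#|G|) : gT := enum_val i.

(* Acting by e_g |-> f g x e_(g x) on row vectors, so that products of
   matrices follow products in G. *)
Definition treg (x : gT) : 'M[algC]_#|G| :=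
  (\matrix_(i, j) (f (el i) x *+ (j == rk (el i * x)%g)))%R.

Let Gel i : el i \in G. Proof. exact: enum_valP. Qed.
Let rkK x : x \in G -> el (rk x) = x. Proof. exact: enum_rankK_in. Qed.

Lemma coc_neq0 x y : x \in G -> y \in G -> (f x y != 0)%R.
Proof. exact: cf.1. Qed.

Lemma cocE x y z : x \in G -> y \in G -> z \in G ->
  (f x y * f (x * y)%g z = f y z * f x (y * z)%g)%R.
Proof. exact: cf.2. Qed.

Lemma tregM x y : x \in G -> y \in G ->
  (treg x *m treg y = f x y *: treg (x * y)%g)%R.
Proof.
move=> Gx Gy; apply/matrixP=> i j; rewrite !mxE (bigD1 (rk (el i * x))) //=.
rewrite big1 => [|l /negPf l'i]; last by rewrite mxE l'i mulr0n mul0r.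
rewrite !mxE eqxx mulr1n addr0 rkK ?groupM // mulgA mulrnAr mulrnAr.
by rewrite cocE.
Qed.

(** Cocycles are not normalized: [f 1 1] takes the place of 1, by the cocycle identity at [x], 1,
    1. *)
Lemma coc1r x : x \in G -> f x 1 = f 1 1.
Proof.
move=> Gx; apply: (mulfI (coc_neq0 Gx (group1 G))).
by have := cocE Gx (group1 G) (group1 G); rewrite !mulg1 mulrC => ->; rewrite mulrC.
Qed.

Lemma treg1 : treg 1 = ((f 1 1)%:M)%R.
Proof.
apply/matrixP=> i j; rewrite !mxE mulg1 coc1r // eq_sym.
by rewrite /rk /el enum_valK_in.
Qed.

Lemma treg_unit x : x \in G -> treg x \in unitmx.
Proof.
move=> Gx; have Gx' : x^-1 \in G by rewrite groupV.
have nz : (f x x^-1 * f 1 1 != 0)%R by rewrite mulf_neq0 ?coc_neq0.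
have [] // := @mulmx1_unit _ _ (treg x) ((f x x^-1 * f 1 1)^-1 *: treg x^-1)%R.
rewrite -scalemxAr tregM // mulgV treg1 scale_scalar_mx scale_scalar_mx.
by rewrite mulVf.
Qed.

(** Turns two rewritings of one product of matrices [treg x] into an identity between the scalars
    collected. *)
Lemma scal_unit_inj (a b : algC) (A : 'M[algC]_#|G|) :
  A \in unitmx -> (a *: A = b *: A)%R -> a = b.
Proof.
move=> uA /(congr1 (fun B => B *m invmx A)%R).
rewrite -!scalemxAl mulmxV // !scalemx1 => /matrixP/(_ (rk 1) (rk 1)).
by rewrite !mxE eqxx.
Qed.

(** Eigenvalues on a common eigenvector multiply as the matrices do, up to [f]; hence [f] is a
    coboundary on [H]. *)
Lemma treg_eigen (H : {group gT}) (v : 'rV[algC]_#|G|) : H \subset G ->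
    (v != 0)%R -> {in H, forall x, stablemx v (treg x)} ->
  exists t : gT -> algC, {in H, forall x, t x != 0%R}
    /\ {in H &, forall x y, (f x y * t (x * y)%g = t x * t y)%R}.
Proof.
move=> sHG v0 vst.
have /fin_all_exists[t tP] x : exists a, x \in H -> (v *m treg x = a *: v)%R.
  case Hx: (x \in H); last by exists 0%R.
  by have /sub_rVP[a ->] := vst x Hx; exists a.
have sG x : x \in H -> x \in G by apply: subsetP.
exists t; split=> [x Hx|x y Hx Hy].
  apply: contraNneq v0 => tx0; have := tP x Hx; rewrite tx0 scale0r.
  move/(congr1 (mulmx^~ (invmx (treg x)))).
  by rewrite mulmxK ?treg_unit ?sG // mul0mx => ->.
have : ((f x y * t (x * y)%g) *: v = (t x * t y) *: v)%R.
  rewrite -scalerA -tP ?groupM // scalemxAr -tregM ?sG // mulmxA tP //.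
  by rewrite -scalemxAl tP // scalerA.
move/eqP; rewrite -subr_eq0 -scalerBl scaler_eq0 (negPf v0) orbF subr_eq0.
by move/eqP.
Qed.

End TwistedRegular.

(** * The pairing and the alternating form of a cocycle *)

Definition beta (gT : finGroupType) (f : gT -> gT -> algC) x z : algC :=
  (f x z / f z x)%R.

(** The scalar relating [T x T y] to [T [x, y] T y T x], for [T = treg] and [x, y] central; the
    denominator comes from merging the latter three matrices. *)
Definition gamma (gT : finGroupType) (f : gT -> gT -> algC) x y : algC :=
  (f x y / (f y x * f [~ x, y] (y * x)%g))%R.

Section CocyclePairings.

Variables (gT : finGroupType) (G N : {group gT}).
Hypotheses (N_Z : 'Z(G) = N) (N_der : [~: G, G] = N).
Variable f : gT -> gT -> algC.
Hypothesis cf : cocycle2 G f.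

Local Notation T := (treg G f).
Local Notation m := #|G|.

Let sNG : N \subset G. Proof. by rewrite -N_Z center_sub. Qed.
Let NG z : z \in N -> z \in G. Proof. exact: subsetP. Qed.
Let cN x y : x \in G -> y \in G -> [~ x, y] \in N.
Proof. exact: comm_in. Qed.
Let centralN z x : z \in N -> x \in G -> commute z x.
Proof. exact: central. Qed.
Let f_neq0 x y : x \in G -> y \in G -> (f x y != 0)%R.
Proof. exact: (coc_neq0 cf). Qed.

Lemma beta_neq0 x z : x \in G -> z \in G -> (beta f x z != 0)%R.
Proof. by move=> Gx Gz; rewrite mulf_neq0 ?invr_neq0 ?f_neq0. Qed.

Lemma gamma_neq0 x y : x \in G -> y \in G -> (gamma f x y != 0)%R.
Proof.
move=> Gx Gy; have Gc := NG (cN Gx Gy).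
by rewrite !(mulf_neq0, invr_neq0) ?f_neq0 ?(groupM Gy Gx).
Qed.

(** The trailing factor [A] allows rewriting inside a right-nested product. *)
Lemma treg_beta x z (A : 'M_m) : x \in G -> z \in N ->
  (T x *m (T z *m A) = beta f x z *: (T z *m (T x *m A)))%R.
Proof.
move=> Gx Nz; have Gz := NG Nz.
rewrite !mulmxA !(tregM cf) // (centralN Nz Gx) -!scalemxAl scalerA.
by rewrite divfK ?f_neq0.
Qed.

Lemma treg_gamma x y (A : 'M_m) : x \in G -> y \in G ->
  (T x *m (T y *m A) = gamma f x y *: (T [~ x, y]%g *m (T y *m (T x *m A))))%R.
Proof.
move=> Gx Gy; have Nc := cN Gx Gy; have Gyx : y * x \in G by rewrite groupM.
have -> : (T x *m (T y *m A) = f x y *: (T (x * y)%g *m A))%R.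
  by rewrite mulmxA (tregM cf) // -scalemxAl.
rewrite [in RHS]mulmxA [in RHS]mulmxA -(mulmxA (T _)) !(tregM cf) // -scalemxAr.
rewrite (tregM cf) ?(NG Nc) // (centralN Nc Gyx) -commgC -!scalemxAl !scalerA.
by rewrite -mulrA divfK // mulf_neq0 ?f_neq0 ?(NG Nc).
Qed.

Lemma treg_scal_inj (a b : algC) x y z :
    x \in G -> y \in G -> z \in G ->
  (a *: (T x *m (T y *m T z)) = b *: (T x *m (T y *m T z)))%R -> a = b.
Proof.
by move=> Gx Gy Gz; apply: scal_unit_inj; rewrite !unitmx_mul !(treg_unit cf).
Qed.

Lemma betaMl x y z : x \in G -> y \in G -> z \in N ->
  beta f (x * y) z = (beta f x z * beta f y z)%R.
Proof.
move=> Gx Gy Nz; have Gz := NG Nz.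
have := treg_beta 1%:M%R (groupM Gx Gy) Nz.
rewrite !mulmx1 => /(congr1 (fun A => f x y *: A)%R).
rewrite scalerA mulrC -scalerA scalemxAl scalemxAr -(tregM cf) // -mulmxA.
rewrite -[in LHS](mulmx1 (T z)) (treg_beta _ Gy Nz) -scalemxAr.
rewrite (treg_beta _ Gx Nz) scalerA mulmx1 => /treg_scal_inj <- //.
by rewrite mulrC.
Qed.

Lemma betaMr x z w : x \in G -> z \in N -> w \in N ->
  beta f x (z * w) = (beta f x z * beta f x w)%R.
Proof.
move=> Gx Nz Nw; have [Gz Gw] := (NG Nz, NG Nw).
have := treg_beta 1%:M%R Gx (groupM Nz Nw).
rewrite !mulmx1 => /(congr1 (fun A => f z w *: A)%R).
rewrite scalerA mulrC -scalerA scalemxAr scalemxAl -(tregM cf) // -mulmxA.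
rewrite -[in LHS](mulmx1 (T w)) (treg_beta _ Gx Nz) (treg_beta _ Gx Nw).
by rewrite -scalemxAr scalerA mulmx1 => /treg_scal_inj ->.
Qed.

(** By [betaMl], [x |-> beta f x z] is a homomorphism into a commutative group. *)
Lemma beta_commg x y z : x \in G -> y \in G -> z \in N ->
  beta f [~ x, y] z = 1%R.
Proof.
move=> Gx Gy Nz; have Gc := NG (cN Gx Gy).
have nz : (beta f y z * beta f x z != 0)%R.
  by rewrite mulf_neq0 ?beta_neq0 ?(NG Nz).
apply: (mulfI nz); rewrite mulr1 -(betaMl Gy Gx Nz).
by rewrite -(betaMl (groupM Gy Gx) Gc Nz) -commgC !betaMl // mulrC.
Qed.

(* The two ways of rewriting T x T y T z as a multiple of T z T y T x. *)
Lemma beta_jacobi x y z : x \in G -> y \in G -> z \in G ->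
  beta f y [~ x, z] = (beta f x [~ y, z] * beta f z [~ x, y])%R.
Proof.
move=> Gx Gy Gz; have [[Nxy Nxz] Nyz] := (cN Gx Gy, cN Gx Gz, cN Gy Gz).
have [[Gxy Gxz] Gyz] := (NG Nxy, NG Nxz, NG Nyz).
pose U := (T z *m (T y *m (T x *m 1%:M)) : 'M[algC]_m)%R.
pose V := (T [~ x, y]%g *m (T [~ x, z]%g *m (T [~ y, z]%g *m U)))%R.
have path1 : (T x *m (T y *m (T z *m 1%:M)) = (gamma f x y * gamma f x z
    * beta f y [~ x, z]%g * gamma f y z) *: V)%R.
  rewrite (treg_gamma _ Gx Gy) (treg_gamma _ Gx Gz) -scalemxAr.
  rewrite (treg_beta _ Gy Nxz) (treg_gamma _ Gy Gz) -!scalemxAr !scalerA.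
  by rewrite -!mulrA.
have path2 : (T x *m (T y *m (T z *m 1%:M)) = (gamma f y z * gamma f x z
    * gamma f x y * (beta f x [~ y, z]%g * beta f z [~ x, y]%g)) *: V)%R.
  rewrite (treg_gamma _ Gy Gz) -!scalemxAr.
  rewrite (treg_beta _ Gx Nyz) (treg_gamma _ Gx Gz).
  rewrite -!scalemxAr (treg_gamma _ Gx Gy) -!scalemxAr (treg_beta _ Gz Nxy).
  (* Sorting the three matrices of commutators costs no scalar, by [beta_commg]. *)
  rewrite -!scalemxAr (treg_beta _ Gyz Nxz) (beta_commg Gy Gz Nxz) scale1r.
  rewrite (treg_beta _ Gyz Nxy) (beta_commg Gy Gz Nxy) scale1r.
  rewrite (treg_beta _ Gxz Nxy) (beta_commg Gx Gz Nxy) scale1r !scalerA.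
  by congr (_ *: _)%R; ring.
move: path2; rewrite path1 => /scal_unit_inj eqs.
have nz : (gamma f y z * gamma f x z * gamma f x y != 0)%R.
  by rewrite mulf_neq0 ?gamma_neq0 // mulf_neq0 ?gamma_neq0.
apply: (mulfI nz); rewrite -eqs.
  by ring.
by rewrite !unitmx_mul !(treg_unit cf) ?unitmx1.
Qed.

Lemma beta_is_jacobi : jacobi G N (beta f).
Proof.
split=> [x z Gx /NG Gz||x z w|]; first exact: beta_neq0.
- exact: betaMl.
- exact: betaMr.
- exact: beta_jacobi.
Qed.

(** Dividing [T z] by [s z] yields a homomorphism on [N]: the central extension defined by [f]
    splits over [N]. *)
Definition splitting (s : gT -> algC) :=
  {in N, forall z, s z != 0%R} /\
  {in N &, forall z w, (f z w * s (z * w)%g = s z * s w)%R}.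

Definition alpha (s : gT -> algC) x y : algC := (gamma f x y * s [~ x, y]%g)%R.

(** * The alternating form attached to a splitting when [beta] is trivial *)

Section Alpha.

Hypothesis beta1 : {in G & N, forall x z, beta f x z = 1%R}.

(** Trivial [beta] makes the matrices [T z], for [z] in [N], commute; over [algC] they share an
    eigenvector. *)
Lemma splitting_exists : exists s, splitting s.
Proof.
have m_gt0 : 0 < m by rewrite cardG_gt0.
have [|v v0 /allP vst] :=
    @common_eigenvector algC m [seq T z | z in N] m_gt0; last first.
  apply: (treg_eigen cf sNG v0) => z Nz.
  by apply: (vst (T z)); apply: image_f.
move=> _ _ /imageP[z Nz ->] /imageP[w Nw ->].
have := treg_beta 1%:M%R (NG Nz) Nw; rewrite !mulmx1 beta1 ?NG // scale1r.
exact.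
Qed.

Variable s : gT -> algC.
Hypothesis sP : splitting s.

Let s_neq0 z : z \in N -> (s z != 0)%R. Proof. exact: sP.1. Qed.

Definition tsplit z : 'M[algC]_m := ((s z)^-1 *: T z)%R.
Local Notation S := tsplit.

Lemma tsplitE z : z \in N -> T z = (s z *: S z)%R.
Proof. by move=> Nz; rewrite scalerA divff ?s_neq0 // scale1r. Qed.

Lemma tsplitM z w : z \in N -> w \in N -> (S z *m S w = S (z * w)%g)%R.
Proof.
move=> Nz Nw; rewrite -scalemxAl -scalemxAr (tregM cf) ?NG // !scalerA.
congr (_ *: _)%R; rewrite -invfM -(sP.2 z w) // invfM mulrAC mulVf ?mul1r //.
by rewrite f_neq0 ?NG.
Qed.

Lemma tsplit_unit z : z \in N -> S z \in unitmx.
Proof.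
move=> Nz; have := treg_unit cf (NG Nz).
by rewrite /tsplit !unitmxE detZ unitrM unitrX // unitfE invr_neq0 ?s_neq0.
Qed.

Lemma tsplit1 : S 1 = 1%:M%R.
Proof.
have uS := tsplit_unit (group1 N).
apply: (row_free_inj (_ : row_free (S 1))); rewrite ?row_free_unit //.
by rewrite tsplitM ?mulg1 ?mul1mx.
Qed.

Lemma tsplitC x z (A : 'M_m) : x \in G -> z \in N ->
  (T x *m (S z *m A) = S z *m (T x *m A))%R.
Proof.
move=> Gx Nz; rewrite /tsplit -!scalemxAl -scalemxAr (treg_beta _ Gx Nz).
by rewrite beta1 // scale1r.
Qed.

Lemma treg_alpha x y (A : 'M_m) : x \in G -> y \in G ->
  (T x *m (T y *m A) = alpha s x y *: (S [~ x, y]%g *m (T y *m (T x *m A))))%R.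
Proof.
move=> Gx Gy; rewrite (treg_gamma _ Gx Gy) (tsplitE (cN Gx Gy)).
by rewrite -scalemxAl scalerA.
Qed.

(** Moving [T z] across [T (x * y)] at once or in two steps collects the same scalar, since the
    corrected matrices of commutators multiply without a factor. *)
Lemma alphaMl x y z : x \in G -> y \in G -> z \in G ->
  alpha s (x * y) z = (alpha s x z * alpha s y z)%R.
Proof.
move=> Gx Gy Gz; have Gxy := groupM Gx Gy.
have [Nxz Nyz] := (cN Gx Gz, cN Gy Gz).
pose U := (T x *m T y)%R : 'M[algC]_m.
have defU : U = (f x y *: T (x * y)%g)%R by rewrite -(tregM cf).
have uU : (S [~ x * y, z]%g *m (T z *m U))%R \in unitmx.
  by rewrite !unitmx_mul !(treg_unit cf) // tsplit_unit // cN.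
apply: (scal_unit_inj uU); rewrite {1}defU -!scalemxAr scalerA mulrC -[LHS]scalerA.
rewrite -[T (x * y)]mulmx1 -(treg_alpha _ Gxy Gz) mulmx1 scalemxAl -defU.
rewrite -mulmxA -{1}[T z]mulmx1 (treg_alpha _ Gy Gz) -scalemxAr.
rewrite (tsplitC _ Gx Nyz) (treg_alpha _ Gx Gz) -scalemxAr scalerA mulmx1.
rewrite (mulmxA (S _) (S _)) tsplitM // (commMl N_Z N_der) // mulrC.
by rewrite (centralN Nyz (NG Nxz)).
Qed.

Lemma alphaC x y : x \in G -> y \in G -> (alpha s x y * alpha s y x = 1)%R.
Proof.
move=> Gx Gy; have [Nxy Nyx] := (cN Gx Gy, cN Gy Gx).
have : ((alpha s x y * alpha s y x) *: (T x *m (T y *m 1%:M)) =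
        1 *: (T x *m (T y *m 1%:M)))%R.
  rewrite scale1r [in RHS](treg_alpha _ Gx Gy) (treg_alpha _ Gy Gx).
  rewrite -scalemxAr scalerA [in RHS](mulmxA (S _) (S _)) tsplitM //.
  by rewrite -invg_comm mulVg tsplit1 mul1mx.
by move/scal_unit_inj; apply; rewrite !unitmx_mul !(treg_unit cf) ?unitmx1.
Qed.

Lemma alphaxx x : x \in G -> alpha s x x = 1%R.
Proof.
move=> Gx; have := treg_alpha 1%:M%R Gx Gx.
have -> : [~ x, x] = 1 by apply/eqP/commgP.
rewrite tsplit1 mul1mx -{1}[(_ *m _)%R]scale1r => /scal_unit_inj -> //.
by rewrite !unitmx_mul !(treg_unit cf) ?unitmx1.
Qed.

Lemma alpha_central z y : z \in N -> y \in G -> alpha s z y = 1%R.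
Proof.
move=> Nz Gy; have Gz := NG Nz; have := treg_alpha 1%:M%R Gy Gz.
have -> : [~ y, z] = 1 by apply/eqP/commgP/commute_sym/centralN.
rewrite tsplit1 mul1mx (treg_beta _ Gy Nz) beta1 // scale1r.
rewrite -{1}[(_ *m _)%R]scale1r => /scal_unit_inj eq1.
have := alphaC Gz Gy; rewrite -eq1 ?mulr1 //.
by rewrite !unitmx_mul !(treg_unit cf) ?unitmx1.
Qed.

Lemma alphaXl x y i : x \in G -> y \in G -> alpha s (x ^+ i) y = (alpha s x y ^+ i)%R.
Proof.
move=> Gx Gy; elim: i => [|i IHi]; first by rewrite expg0 expr0 alpha_central.
by rewrite expgS exprS alphaMl ?groupX // IHi.
Qed.

Lemma alpha_gen_trivial d (g : 'I_d -> gT) :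
    (forall i, g i \in G) -> <<[set g i | i in 'I_d]>> = G ->
    (forall i j : 'I_d, i < j -> alpha s (g i) (g j) = 1%R) ->
  {in G &, forall x y, alpha s x y = 1%R}.
Proof.
move=> Gg genG gij.
have gg i j : alpha s (g i) (g j) = 1%R.
  case: (ltngtP i j) => [/gij//|/gij ji|/val_inj->]; last exact: alphaxx.
  by have := alphaC (Gg i) (Gg j); rewrite ji mulr1.
have left_ker y : y \in G -> (forall i, alpha s (g i) y = 1%R) ->
    {in G, forall x, alpha s x y = 1%R}.
  move=> Gy giy; have gK : group_set [set x in G | alpha s x y == 1%R].
    apply/group_setP; split; first by rewrite inE group1 alpha_central ?eqxx.
    move=> a b; rewrite !inE => /andP[Ga /eqP a1] /andP[Gb /eqP b1].
    by rewrite groupM //= alphaMl // a1 b1 mulr1.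
  have : <<[set g i | i in 'I_d]>> \subset group gK.
    rewrite gen_subG; apply/subsetP=> _ /imsetP[i _ ->].
    by rewrite inE Gg giy /=.
  rewrite genG => /subsetP sGK.
  by move=> x /sGK; rewrite inE => /andP[_ /eqP].
move=> x y Gx Gy; apply: (left_ker y) => // i.
have := alphaC (Gg i) Gy.
by rewrite (left_ker (g i) (Gg i) (gg^~ i) y Gy) mulr1.
Qed.

(* When alpha is trivial, the matrices treg x commute on the image of the
   projector P = sum_z tsplit z; a common eigenvector there trivializes f. *)
Lemma alpha_trivial : {in G &, forall x y, alpha s x y = 1%R} ->
  exists t : gT -> algC, {in G, forall x, t x != 0%R} /\
    {in G &, forall x y, (f x y * t (x * y)%g = t x * t y)%R}.
Proof.
move=> alpha1; pose P := (\sum_(z in N) S z)%R.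
have PT x : x \in G -> (P *m T x = T x *m P)%R.
  move=> Gx; rewrite mulmx_suml mulmx_sumr; apply: eq_bigr => z Nz.
  by rewrite -[S z in RHS]mulmx1 tsplitC // mulmx1.
have PS w : w \in N -> (P *m S w = P)%R.
  move=> Nw; rewrite mulmx_suml [RHS](reindex_inj (mulIg w)) /=.
  apply: eq_big => [z|z Nz]; first by rewrite groupMr.
  by rewrite tsplitM.
(* [P] absorbs the matrix of the commutator [x, y]. *)
have P_comm x y : x \in G -> y \in G -> (P *m (T x *m T y) = P *m (T y *m T x))%R.
  move=> Gx Gy; rewrite -[T y in LHS]mulmx1 (treg_alpha _ Gx Gy) alpha1 //.
  by rewrite scale1r mulmx1 mulmxA PS // cN.
(* Only [z = 1] contributes to the diagonal entry at the identity. *)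
have P_nz : (P != 0)%R.
  pose i := enum_rank_in (group1 G) 1.
  apply/eqP=> /matrixP/(_ i i)/eqP; rewrite summxE (bigD1 1) //= big1 ?addr0.
    rewrite !mxE enum_rankK_in // mul1g eqxx mulr1n.
    by rewrite mulf_eq0 invr_eq0 (negPf (s_neq0 _)) // (negPf (f_neq0 _ _)).
  move=> z /andP[Nz z1]; rewrite !mxE enum_rankK_in // mul1g.
  rewrite (_ : (i == _) = false) ?mulr0n ?mulr0 //.
  apply: contraNF z1 => /eqP/(congr1 enum_val).
  by rewrite !enum_rankK_in ?NG // => <-.
have stP x : x \in G -> stablemx P (T x) by move=> Gx; rewrite PT // submxMl.
have r_gt0 : 0 < \rank P by rewrite lt0n mxrank_eq0.
have [|v v0 /allP vst] := @common_eigenvector algC (\rank P)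
    [seq restrictmx P (T x) | x in G] r_gt0; last first.
  apply: (treg_eigen cf (subxx G) (v := v *m row_base P)%R).
    by rewrite mulmx_free_eq0 ?row_base_free.
  move=> x Gx; rewrite -stablemx_restrict ?stP //.
  by apply: (vst (restrictmx P (T x))); apply: image_f.
move=> _ _ /imageP[x Gx ->] /imageP[y Gy ->].
rewrite /comm_mx -!conjmxM ?inE ?stablemx_row_base ?stP // /conjmx.
congr (_ *m _)%R; have /submxP[D ->] : (row_base P <= P)%MS by rewrite eq_row_base.
by rewrite -!mulmxA P_comm.
Qed.

End Alpha.

End CocyclePairings.

(** * Counting cohomology classes *)

Lemma bigminn_le (I : eqType) (r : seq I) (P : pred I) (F : I -> nat) m i :
  i \in r -> P i -> \big[minn/m]_(j <- r | P j) F j <= F i.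
Proof.
elim: r => // j r IHr; rewrite inE big_cons => /predU1P[<- ->|ri Pi].
  exact: geq_minl.
by case: ifP => _; rewrite ?geq_min IHr ?orbT.
Qed.

(** * Numbers of generators and orders *)

Lemma mingensE (gT : finGroupType) (H : {group gT}) : mingens H = 'm(H).
Proof.
apply/eqP; rewrite eqn_leq; apply/andP; split.
  have [B genB <-] := grank_witness H.
  by apply: bigminn_le; rewrite ?mem_index_enum //= genB.
apply: (big_ind (fun m => 'm(H) <= m)).
(* The default value [#|H|] of the minimum is harmless: [H] generates itself. *)
- by rewrite -{1}(genGid H) grank_min.
- by move=> a b; rewrite leq_min => -> ->.
by move=> A /eqP <-; apply: grank_min.
Qed.

Lemma card_abelem_grank (p : nat) (gT : finGroupType) (H : {group gT}) :
  p.-abelem H -> #|H| = (p ^ 'm(H))%N.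
Proof.
move=> abH; rewrite grank_abelian ?(abelem_abelian abH) // (rank_abelem abH).
exact: card_pgroup (abelem_pgroup abH).
Qed.

(** Burnside's basis theorem. *)
Lemma card_quotient_Phi (p : nat) (gT : finGroupType) (G : {group gT}) :
  p.-group G -> #|G / 'Phi(G)| = (p ^ 'm(G))%N.
Proof.
move=> pG; rewrite (card_abelem_grank (Phi_quotient_abelem pG)).
have nPhiG : G \subset 'N('Phi(G)) := gFnorm _ G.
congr (_ ^ _)%N; apply/eqP; rewrite eqn_leq; apply/andP; split.
  have [B genB <-] := grank_witness G.
  have sBG : B \subset G by rewrite -genB subset_gen.
  have defQ : G / 'Phi(G) = <<B / 'Phi(G)>>.
    by rewrite -quotient_gen ?genB //; apply: subset_trans nPhiG.
  rewrite /= defQ; apply: leq_trans (grank_min _) _; rewrite /quotient morphimEsub.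
    exact: leq_imset_card.
  exact: subset_trans nPhiG.
have [C genC cardC] := grank_witness (G / 'Phi(G)).
have sCG : C \subset G / 'Phi(G) by rewrite -genC subset_gen.
pose B := [set repr (set_of_coset x) | x in C].
have nB : B \subset 'N('Phi(G)).
  by apply/subsetP=> _ /imsetP[x _ ->]; apply: repr_coset_norm.
have imB : B / 'Phi(G) = C.
  rewrite /quotient morphimEsub // -imset_comp -[RHS]imset_id.
  by apply: eq_imset => x; rewrite /= coset_reprK.
have sBG : B \subset G.
  apply/subsetP=> y By; have Ny := subsetP nB y By.
  rewrite -(quotientGK (Phi_normal G)) mem_morphpre //.
  by apply: (subsetP sCG); rewrite -imB mem_morphim.
have defG : 'Phi(G) <*> B = G.
  apply/eqP; rewrite eqEsubset join_subG Phi_sub sBG /=.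
  rewrite -(quotientSGK nPhiG) ?joing_subl //.
  rewrite -{1}genC -imB gen_subG quotientS ?joing_subr //.
rewrite -cardC -{1}(Phi_nongen defG) (leq_trans (grank_min B)) //.
exact: leq_imset_card.
Qed.

(** Discrete logarithms embed [X] into the functions from [J] to ['I_p]. *)
Lemma card_roots_of_unity (X J : finType) (p : nat) (Phi : X -> J -> algC) :
    0 < p -> (forall x j, Phi x j ^+ p = 1)%R ->
    (forall x y, Phi x =1 Phi y -> x = y) ->
  #|X| <= (p ^ #|J|)%N.
Proof.
move=> p_gt0 Phi1 Phi_inj; have [w prim_w] := C_prim_root_exists p_gt0.
pose lg x j : 'I_p := sval (prim_rootP prim_w (Phi1 x j)).
have lgE x j : Phi x j = (w ^+ lg x j)%R by rewrite /lg; case: prim_rootP.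
pose F x := [ffun j => lg x j].
have injF : injective F.
  move=> x y /ffunP eqF; apply: Phi_inj => j.
  by have := eqF j; rewrite !ffunE !lgE => ->.
by have := leq_card F injF; rewrite card_ffun card_ord.
Qed.

Lemma card_ltn_pairs d :
  #|{: {ij : 'I_d * 'I_d | ij.1 < ij.2}}| = 'C(d, 2).
Proof.
rewrite card_sig -sum1_card -bin2_sum big_mkord.
transitivity (\sum_(i < d) \sum_(j < d | i < j) 1).
  by rewrite pair_big_dep; apply: eq_bigl.
rewrite (exchange_big_dep xpredT) //=; apply: eq_bigr => j _.
rewrite -(big_ord_widen d (fun=> 1%N) (ltnW (ltn_ord j))).
by rewrite sum_nat_const card_ord muln1.
Qed.

Lemma cocycle2_div (gT : finGroupType) (G : {group gT}) (f g : gT -> gT -> algC) :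
  cocycle2 G f -> cocycle2 G g -> cocycle2 G (fun x y => f x y / g x y)%R.
Proof.
move=> [f0 fE] [g0 gE]; split=> [x y Gx Gy|x y z Gx Gy Gz].
  by rewrite mulf_neq0 ?invr_neq0 ?f0 ?g0.
by rewrite mulrACA fE // -invfM gE // invfM mulrACA.
Qed.

Lemma beta_div (gT : finGroupType) (f g : gT -> gT -> algC) x y :
  beta (fun x y => f x y / g x y)%R x y = (beta f x y / beta g x y)%R.
Proof. by rewrite /beta !invfM !invrK mulrACA. Qed.

Lemma gamma_div (gT : finGroupType) (f g : gT -> gT -> algC) x y :
  gamma (fun x y => f x y / g x y)%R x y = (gamma f x y / gamma g x y)%R.
Proof. by rewrite /gamma !invfM !invrK; ring. Qed.

Lemma splitting_div (gT : finGroupType) (N : {group gT}) f g s t :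
    splitting N f s -> splitting N g t ->
  splitting N (fun x y => f x y / g x y)%R (fun z => s z / t z)%R.
Proof.
move=> [s0 sE] [t0 tE]; split=> [z Nz|z w Nz Nw].
  by rewrite mulf_neq0 ?invr_neq0 ?s0 ?t0.
by rewrite mulrACA sE // -invfM tE // invfM mulrACA.
Qed.

(** Multiplying by the characters of [N] produces the [#|N|] splittings used in the count. *)
Lemma splitting_lin_char (gT : finGroupType) (N : {group gT}) f s (xi : 'CF(N)) :
  splitting N f s -> xi \is a linear_char ->
  splitting N f (fun z => s z * xi z)%R.
Proof.
move=> [s0 sE] lin_xi; split=> [z Nz|z w Nz Nw].
  by rewrite mulf_neq0 ?s0 ?lin_char_neq0.
by rewrite lin_charM // mulrA sE // mulrACA.
Qed.

Section Counting.

Variables (p d : nat) (gT : finGroupType) (G N : {group gT}).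
Hypotheses (p_pr : prime p) (abelN : p.-abelem N).
Hypotheses (N_Z : 'Z(G) = N) (N_der : [~: G, G] = N).
Hypothesis G_expN : {in G, forall x, x ^+ p \in N}.
Variable g : 'I_d -> gT.
Hypotheses (Gg : forall i, g i \in G) (genG : <<[set g i | i in 'I_d]>> = G).

(** Pairs of a class and a character of [N] inject into tuples of p-th roots of unity: [q] values of
    [beta], then the values of [alpha] on pairs of generators. The characters account for the factor
    [#|N|]. *)
Lemma card_cocycles q r (f : 'I_r -> gT -> gT -> algC) :
    (forall i, cocycle2 G (f i)) ->
    (forall i j, i != j -> ~ cohomologous G (f i) (f j)) ->
    determines G N q (fun=> True) (fun b => trivial_on b G N) ->
  r * #|N| <= p ^ (q + 'C(d, 2)).
Proof.
move=> cf f_inj [L [leL inL detL]].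
have sNG : N \subset G by rewrite -N_Z center_sub.
pose key i := [seq beta (f i) c.1 c.2 | c <- L].
(* One reference cocycle for each value of [key]; dividing by it makes [beta] trivial, so that
   [alpha] is available. *)
pose base i := choose (fun j => key j == key i) i.
have keyE i : key (base i) = key i.
  by apply/eqP; apply: (@chooseP _ (fun j => key j == key i)); rewrite eqxx.
have baseE i j : key i = key j -> base i = base j.
  move=> eq_key; rewrite /base -eq_key.
  by apply: choose_id; rewrite ?eqxx // eq_key.
pose h i x y := (f i x y / f (base i) x y)%R.
have ch i : cocycle2 G (h i) by apply: cocycle2_div.
have beta_h i : {in G & N, forall x z, beta (h i) x z = 1%R}.
  apply: detL => //; first exact: (beta_is_jacobi N_Z N_der (ch i)).
  move=> c Lc; rewrite beta_div.
  have -> : beta (f i) c.1 c.2 = beta (f (base i)) c.1 c.2.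
    have /(congr1 (nth 0%R ^~ (index c L))) := keyE i.
    by rewrite !(nth_map c) ?index_mem // !nth_index.
  have /andP[Gc1 Nc2] := inL c Lc.
  by rewrite divff // (beta_neq0 (cf _)) // (subsetP sNG).
have /fin_all_exists[s sP] i : exists s, splitting N (h i) s.
  exact: (splitting_exists N_Z (ch i) (beta_h i)).
pose s' (u : 'I_r * Iirr N) z := (s u.1 z * 'chi_u.2 z)%R.
have lin (c : Iirr N) : ('chi_c)%R \is a linear_char.
  exact/char_abelianP/(abelem_abelian abelN).
have s'P u : splitting N (h u.1) (s' u) by apply: splitting_lin_char.
pose J := ('I_(size L) + {ij : 'I_d * 'I_d | ij.1 < ij.2})%type.
pose Phi (u : 'I_r * Iirr N) (j : J) := match j with
  | inl l => let c := tnth (in_tuple L) l in beta (f u.1) c.1 c.2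
  | inr ij => alpha (h u.1) (s' u) (g (val ij).1) (g (val ij).2)
  end.
have Phi_roots u j : (Phi u j ^+ p = 1)%R.
  case: j => [l|[[i j] lt_ij]] /=.
    set c := tnth _ l; have /andP[Gc1 Nc2] := inL c (mem_tnth l (in_tuple L)).
    have jb := beta_is_jacobi N_Z N_der (cf u.1).
    have betaX e : beta (f u.1) c.1 (c.2 ^+ e) = (beta (f u.1) c.1 c.2 ^+ e)%R.
      elim: e => [|e IHe]; first by rewrite expg0 expr0 (jac1r jb).
      by rewrite expgS exprS (jacMr jb) ?groupX // IHe.
    have [_ expN] := abelemP p_pr abelN.
    by rewrite -betaX expN // (jac1r jb).
  rewrite -(alphaXl N_Z N_der (ch u.1) (beta_h u.1) (s'P u)) //.
  by rewrite (alpha_central N_Z N_der (ch u.1) (beta_h u.1) (s'P u)) ?G_expN.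
have Phi_inj u v : Phi u =1 Phi v -> u = v.
  case: u v => i c [j c'] eqPhi.
  have eq_key : key i = key j.
    rewrite /key; apply/eq_in_map => e Le.
    have lt_e : index e L < size L by rewrite index_mem.
    have := eqPhi (inl (Ordinal lt_e)).
    by rewrite /= (tnth_nth e) /= nth_index.
  have eq_base := baseE _ _ eq_key.
  (* The references agree, so [F] is also [f i / f j]; its [alpha] for the quotient splitting is
     trivial, whence a coboundary. *)
  pose F x y := (h i x y / h j x y)%R.
  have cF : cocycle2 G F by apply: cocycle2_div.
  have betaF : {in G & N, forall x z, beta F x z = 1%R}.
    by move=> x z Gx Nz; rewrite beta_div !beta_h // divr1.
  pose t z := (s' (i, c) z / s' (j, c') z)%R.
  have tP : splitting N F t := splitting_div (s'P (i, c)) (s'P (j, c')).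
  have alphaF : {in G &, forall x y, alpha F t x y = 1%R}.
    apply: (alpha_gen_trivial N_Z N_der cF betaF tP Gg genG) => a b lt_ab.
    have := eqPhi (inr (exist _ (a, b) lt_ab)); rewrite /= => eq_ab.
    rewrite /alpha gamma_div /t mulrACA -invfM.
    rewrite -[X in (X * _)%R]/(alpha (h i) (s' (i, c)) (g a) (g b)) eq_ab.
    have Gc : [~ g a, g b] \in N by apply: (comm_in N_der).
    rewrite divff // mulf_neq0 ?(gamma_neq0 N_Z N_der (ch j)) //.
    by have [-> //] := s'P (j, c').
  have eq_ij : i = j.
    apply/eqP; apply/negPn/negP; rewrite eq_sym => /f_inj; case.
    have [e [e0 eE]] := alpha_trivial N_Z N_der cF betaF tP alphaF.
    exists e; split=> // x y Gx Gy.
    have [fj0 _] := cf j; have [fb0 _] := cf (base j).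
    apply: (mulIf (e0 _ (groupM Gx Gy))); rewrite divfK ?e0 ?groupM //.
    rewrite -mulrA -eE // mulrA; congr (_ * _)%R.
    by rewrite /F /h eq_base; field; rewrite fj0 ?fb0.
  rewrite {}eq_ij in F cF betaF t tP alphaF eqPhi *.
  congr (_, _); apply: irr_inj; apply/cfun_inP => z Nz.
  (* With equal cocycles, equal [alpha] forces the two characters to agree on commutators, which
     generate [N]. *)
  have gK : group_set [set z in N | ('chi_c z == 'chi_c' z)%R].
    apply/group_setP; split; first by rewrite inE group1 !lin_char1 /=.
    move=> a b; rewrite !inE => /andP[Na /eqP ea] /andP[Nb /eqP eb].
    by rewrite groupM //= !lin_charM // ea eb.
  have : [~: G, G] \subset group gK.
    rewrite gen_subG; apply/subsetP=> _ /imset2P[x y Gx Gy ->].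
    have Nxy : [~ x, y] \in N by apply: (comm_in N_der).
    rewrite inE Nxy /=; apply/eqP.
    have := alphaF x y Gx Gy; rewrite /alpha gamma_div divff; last first.
      exact: (gamma_neq0 N_Z N_der (ch j)).
    have [sj0 _] := sP j.
    rewrite mul1r /t /s' /= invfM mulrACA divff ?sj0 // mul1r.
    move/(congr1 ( *%R^~ ('chi_c' [~ x, y])))%R.
    by rewrite divfK ?mul1r // lin_char_neq0.
  by rewrite N_der => /subsetP/(_ z Nz); rewrite inE Nz => /eqP.
have := card_roots_of_unity (prime_gt0 p_pr) Phi_roots Phi_inj.
rewrite card_prod card_ord card_Iirr_abelian ?(abelem_abelian abelN) //.
move=> le_r; apply: leq_trans le_r _.
rewrite leq_exp2l ?prime_gt1 // card_sum card_ord leq_add //.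
by rewrite card_ltn_pairs.
Qed.

End Counting.

(** * Arithmetic of the exponent and conclusion *)

Lemma mul2_bin2 m : (2 * 'C(m.+1, 2) = m.+1 * m)%N.
Proof. by elim: m => // m IHm; rewrite binS bin1 mulnDr IHm; lia. Qed.

(** As [k < d], no difference [d - i] is truncated. *)
Lemma sum_subn_linear d k :
  k < d -> (2 * (\sum_(2 <= i < k.+2) (d - i)) + k * (k + 3) = 2 * (k * d))%N.
Proof.
elim: k => [|k IHk] lt_kd; first by rewrite big_geq.
rewrite big_nat_recr //= mulnDr addnAC.
have := IHk (ltnW lt_kd); move: (\sum_(2 <= i < k.+2) (d - i)) => S; nia.
Qed.

Lemma exponent_identity d k : 2 < k -> k.+1 < d ->
  ((((d - 1) * (d + k + k)) %/ 2 - (\sum_(2 <= i < k.+2) (d - i)) - (k - 2) + k)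
   = 'C(k.+1, 2) + 2 + 'C(d, 2))%N.
Proof.
case: d => // d k_gt2 lt_kd; rewrite ltnS in lt_kd.
(* The product is even, so halving it is exact. *)
have -> : ((d.+1 - 1) * (d.+1 + k + k) = ('C(d.+1, 2) + d * k) * 2)%N.
  by rewrite mulnDl [('C(_, _) * 2)%N]mulnC mul2_bin2; nia.
rewrite mulnK //.
have := mul2_bin2 k; have := mul2_bin2 d; have := sum_subn_linear (ltnW lt_kd : k < d.+1).
move: (\sum_(2 <= i < k.+2) _) 'C(k.+1, 2) 'C(d.+1, 2) => S a b; nia.
Qed.

Lemma grank_generators (gT : finGroupType) (G : {group gT}) :
  exists g : 'I_('m(G)) -> gT,
    (forall i, g i \in G) /\ <<[set g i | i in 'I_('m(G))]>> = G.
Proof.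
have [B genB cardB] := grank_witness G.
exists (fun i => enum_val (cast_ord (esym cardB) i)); split=> [i|].
  by rewrite -[in X in _ \in X]genB mem_gen ?enum_valP.
rewrite -[RHS]genB; congr <<_>>; apply/setP=> x; apply/imsetP/idP => [[i _ ->]|Bx].
  exact: enum_valP.
exists (cast_ord cardB (enum_rank_in Bx x)) => //.
by rewrite cast_ordK enum_rankK_in.
Qed.

Lemma special_schur_mult (p : nat) (gT : finGroupType) (G : {group gT}) e :
    prime p -> special_pgroup p G ->
    let d := 'm(G) in let k := 'm([~: G, G]) in
    2 < k -> k.+1 < d -> (e + k = 'C(k.+1, 2) + 2 + 'C(d, 2))%N ->
  #|G| = (p ^ (d + k))%N /\ schur_mult_order_le G (p ^ e)%N.
Proof.
move=> p_pr [pG _ defZ defPhi abZ] d k k_gt2 lt_kd def_e.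
pose N := [~: G, G]%G; have p_gt1 := prime_gt1 p_pr.
have abN : p.-abelem N by rewrite /N /= -defZ.
have cardN : #|N| = (p ^ k)%N by apply: card_abelem_grank.
have PhiN : 'Phi(G) = N by rewrite defPhi.
(* The quotient by ['Phi(G) = N] has order [p ^ d], so n = d + k. *)
have cardG : #|G| = (p ^ (d + k))%N.
  rewrite expnD -cardN -PhiN -(card_quotient_Phi pG).
  by rewrite card_quotient ?(gFnorm _ G) // mulnC Lagrange ?Phi_sub.
split=> // r f cf f_inj.
have expN : {in G, forall x, x ^+ p \in N}.
  move=> x Gx; rewrite -PhiN (Phi_joing pG) -(expn1 p).
  by rewrite (subsetP (joing_subr _ _)) // Mho_p_elt // (mem_p_elt pG).
have [g [Gg genG]] := grank_generators G.
have det := jacobi_determined p_pr abN defZ (erefl _) cardN k_gt2 _.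
rewrite cardG cardN -expnS -expnD ltn_exp2l // in det.
have := card_cocycles p_pr abN defZ (erefl _) expN Gg genG cf f_inj (det _).
rewrite -/d -def_e cardN expnD leq_pmul2r ?expn_gt0 ?prime_gt0 //.
by apply; rewrite ltn_add2r.
Qed.

Local Close Scope group_scope.

Theorem theorem3p8 (p : nat) (gT : finGroupType) (G : {group gT}) (n d k : nat) :
  prime p -> special_pgroup p G -> #|G| = p ^ n ->
  mingens G = d -> mingens [~: G, G]%g = k -> 2 < k -> k.+1 < d ->
  schur_mult_order_le G
    (p ^ (((d - 1) * (n + k)) %/ 2 - (\sum_(2 <= i < k.+2) (d - i)) - (k - 2))).
Proof.
move=> p_pr spG cardG; rewrite mingensE (mingensE [~: G, G]%G) => <- <- k_gt2 lt_kd.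
have [cardG' le_M] := special_schur_mult p_pr spG k_gt2 lt_kd
  (exponent_identity k_gt2 lt_kd).
suff -> : n = 'm(G)%g + 'm([~: G, G])%g by [].
by apply/eqP; rewrite -(eqn_exp2l _ _ (prime_gt1 p_pr)) -cardG -cardG'.
Qed.
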